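(* Let $d\ge2$ be an integer, $a\in\mathbb R$, $s,k$ nonzero reals, and $z>w$ reals. Consider the $d+2$ bodies in $\mathbb R^d$ with positions $x_1=(z,0,\dots,0)$, $x_2=(w,0,\dots,0)$, $x_{j+2}=(0,\delta_j)$ for $j=1,\dots,d$, where $\delta_1,\dots,\delta_d\in\mathbb R^{d-1}$ are the vertices of a regular $(d-1)$-simplex with center at the origin and unit side length, and masses $m_1=s$, $m_2=k$, $m_3=\dots=m_{d+2}=1$. Then the equations $L_{1324}=L_{2314}=0$, where $$L_{1324}=m_2(R_{12}-R_{23})\triangle_4-m_4(R_{14}-R_{34})\triangle_2,\qquad L_{2314}=m_1(R_{12}-R_{13})\triangle_4-m_4(R_{24}-R_{34})\triangle_1,$$ are equivalent to the system $$\begin{cases} k\left((z-w)^{2a}-\left(\frac{d-1}{2d}+w^{2}\right)^{a}\right)(z-w)+\left(\left(\frac{d-1}{2d}+z^{2}\right)^{a}-1\right)zd=0,\\[4pt] s\left((z-w)^{2a}-\left(\frac{d-1}{2d}+z^{2}\right)^{a}\right)(z-w)-\left(\left(\frac{d-1}{2d}+w^{2}\right)^{a}-1\right)wd=0. \end{cases}$$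
   Context: $R_{ij}=\|x_i-x_j\|^{2a}$, and for $l\in\{1,\dots,d+2\}$, $\triangle_l=(-1)^{l+1}\det X_l$, where $X_l$ is the $(d+1)\times(d+1)$ matrix with columns $\binom{1}{x_p}$, $p\neq l$, in increasing order of $p$. *)

(* Defs.v *)
From HB Require Import structures.
From mathcomp Require Import all_boot all_order all_algebra.
From mathcomp Require Import all_classical all_reals all_analysis.
Set Implicit Arguments.
Unset Strict Implicit.
Unset Printing Implicit Defensive.
Import Order.TTheory GRing.Theory Num.Theory.
Local Open Scope ring_scope.

(* The norm `|x| that MathComp-Analysis puts on matrices is the sup norm,
   hence this Euclidean norm. *)
Definition enorm (R : realType) (n : nat) (x : 'cV[R]_n) : R :=
  Num.sqrt (\sum_(i < n) x i 0 ^+ 2).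

(* The n vertices of a regular simplex with side length ell. Points at equal
   nonzero pairwise distances are automatically affinely independent. *)
Definition regular_simplex (R : realType) (n e : nat) (ell : R)
    (delta : 'I_n -> 'cV[R]_e) : Prop :=
  forall i j : 'I_n, i != j -> enorm (delta i - delta j) = ell.

Definition barycenter (R : realType) (n e : nat) (delta : 'I_n -> 'cV[R]_e) :
    'cV[R]_e :=
  n%:R^-1 *: \sum_(j < n) delta j.

(* The d+2 bodies are numbered 1, ..., d+2, so body p is the ordinal p - 1. *)
Definition body (d p : nat) : 'I_d.+2 := inord p.-1.
Arguments body {d} p.

Definition Rpow (R : realType) (d : nat) (a : R) (x : 'I_d.+2 -> 'cV[R]_d)
    (i j : 'I_d.+2) : R :=
  enorm (x i - x j) `^ (2 * a).

(* X_l has the columns (1 ; x_p), p <> l: col' l removes column l and keeps the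
   order of the others. *)
Definition Xmx (R : realType) (d : nat) (x : 'I_d.+2 -> 'cV[R]_d)
    (l : 'I_d.+2) : 'M[R]_d.+1 :=
  col' l (\matrix_(i < (1 + d)%N, p < d.+2) (col_mx (const_mx 1 : 'cV_1) (x p)) i 0).

(* The one-based number of l is l.+1, so that (-1)^(l+1) is (-1) ^+ l.+2. *)
Definition triangle (R : realType) (d : nat) (x : 'I_d.+2 -> 'cV[R]_d)
    (l : 'I_d.+2) : R :=
  (-1) ^+ l.+2 * \det (Xmx x l).

Definition L1324 (R : realType) (d : nat) (a : R) (m : 'I_d.+2 -> R)
    (x : 'I_d.+2 -> 'cV[R]_d) : R :=
  let r i j := Rpow a x (body i) (body j) in
  m (body 2) * (r 1%N 2%N - r 2%N 3%N) * triangle x (body 4)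
  - m (body 4) * (r 1%N 4%N - r 3%N 4%N) * triangle x (body 2).

Definition L2314 (R : realType) (d : nat) (a : R) (m : 'I_d.+2 -> R)
    (x : 'I_d.+2 -> 'cV[R]_d) : R :=
  let r i j := Rpow a x (body i) (body j) in
  m (body 1) * (r 1%N 2%N - r 1%N 3%N) * triangle x (body 4)
  - m (body 4) * (r 2%N 4%N - r 3%N 4%N) * triangle x (body 1).

(* The point (t, y) of R^d = R x R^(d-1); the value for d = 0 is irrelevant. *)
Definition prod_point (R : realType) (d : nat) :
    R -> 'cV[R]_d.-1 -> 'cV[R]_d :=
  match d return R -> 'cV[R]_d.-1 -> 'cV[R]_d with
  | 0%N => fun _ _ => 0
  | n.+1 => fun t y => col_mx (const_mx t : 'cV_1) y
  end.

Definition position (R : realType) (d : nat) (z w : R)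
    (delta : 'I_d -> 'cV[R]_d.-1) (p : 'I_d.+2) : 'cV[R]_d :=
  match fintype.split (p : 'I_(2 + d)%N) with
  | inl q => prod_point (if q == 0 then z else w) 0
  | inr j => prod_point 0 (delta j)
  end.

Definition mass (R : realType) (d : nat) (s k : R) (p : 'I_d.+2) : R :=
  if p == body 1 then s else if p == body 2 then k else 1.

(* Main.v *)
Require Import Defs.
From HB Require Import structures.
From mathcomp Require Import all_boot all_order all_algebra.
From mathcomp Require Import ring.
From mathcomp Require Import all_classical all_reals all_analysis.
Set Implicit Arguments.
Unset Strict Implicit.
Unset Printing Implicit Defensive.
Import Order.TTheory GRing.Theory Num.Theory.
Local Open Scope ring_scope.

(** The signed minors [triangle x l] form an affine dependency of the points
    [x l]. For the present configuration, the Gram matrix of the centered simplex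
    has diagonal entries (d-1)/(2d) and off-diagonal entries -1/(2d), so every
    affine dependency has equal weights on the simplex vertices and is therefore
    a multiple of (-w, z, -(z-w)/d, ..., -(z-w)/d). The multiple given by the
    minors is nonzero, and cancelling it turns the L-equations into the system. *)

(** * Euclidean dot product and squared norms *)

Section Dot.
Variables (R : realType) (e : nat).
Implicit Types u v : 'cV[R]_e.

Definition dot u v : R := (u^T *m v) 0 0.

Lemma dotE u v : dot u v = \sum_(i < e) u i 0 * v i 0.
Proof. by rewrite /dot mxE; apply: eq_bigr => i _; rewrite mxE. Qed.

Lemma dotNN u v : dot (- u) (- v) = dot u v.
Proof. by rewrite !dotE; apply: eq_bigr => i _; rewrite !mxE mulrNN. Qed.

Lemma dot_sumr (I : finType) u (c : I -> R) (v : I -> 'cV[R]_e) :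
  dot u (\sum_i c i *: v i) = \sum_i c i * dot u (v i).
Proof.
rewrite /dot mulmx_sumr summxE; apply: eq_bigr => i _.
by rewrite -scalemxAr mxE.
Qed.

Lemma dotBB u v : dot (u - v) (u - v) = dot u u + dot v v - 2 * dot u v.
Proof.
rewrite !dotE mulr_sumr -big_split -sumrB /=; apply: eq_bigr => i _.
by rewrite !mxE; ring.
Qed.

Lemma enorm_sqr u : enorm u ^+ 2 = dot u u.
Proof.
rewrite /enorm sqr_sqrtr ?dotE.
  by apply: eq_bigr => i _; rewrite expr2.
by apply: sumr_ge0 => i _; rewrite sqr_ge0.
Qed.

(** The exponent [2 * a] absorbs the square root, so each [Rpow] becomes a power of a polynomial in
    the coordinates. *)
Lemma enorm_powR u (a : R) : enorm u `^ (2 * a) = dot u u `^ a.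
Proof. by rewrite powRrM powR_mulrn ?sqrtr_ge0// enorm_sqr. Qed.

End Dot.

Lemma dot_col_mx (R : realType) (m n : nat) (u u' : 'cV[R]_m) (v v' : 'cV[R]_n) :
  dot (col_mx u v) (col_mx u' v') = dot u u' + dot v v'.
Proof. by rewrite /dot tr_col_mx mul_row_col mxE. Qed.

(** * Gram matrix of a centered regular simplex *)

Section CenteredSimplex.
Variables (R : realType) (n e : nat) (delta : 'I_n -> 'cV[R]_e).
Hypothesis n_gt0 : (0 < n)%N.
Hypothesis hdelta : regular_simplex 1 delta.
Hypothesis hcenter : barycenter delta = 0.

Let n_neq0 : n%:R != 0 :> R.
Proof. by rewrite pnatr_eq0 -lt0n. Qed.

Lemma simplex_sum0 : \sum_j delta j = 0.
Proof.
by move/eqP: hcenter; rewrite scaler_eq0 invr_eq0 (negPf n_neq0) => /eqP.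
Qed.

Lemma simplex_dotBB i j : dot (delta i - delta j) (delta i - delta j) = (i != j)%:R.
Proof.
have [->|ij] := eqVneq i j.
  by rewrite subrr dotE big1// => k _; rewrite mxE mul0r.
by rewrite -enorm_sqr hdelta// expr1n.
Qed.

Lemma sum_neq i : \sum_(j < n) (i != j)%:R = n%:R - 1 :> R.
Proof.
rewrite (bigD1 i)//= eqxx add0r (eq_bigr (fun=> 1)) => [|j ji]; last first.
  by rewrite eq_sym ji.
rewrite sumr_const cardC1 card_ord.
by case: n n_gt0 => // m _; rewrite /= mulrSr addrK.
Qed.

(** Summing the squared distances from vertex j over all k kills the cross terms, because the
    vertices sum to 0. This gives n |delta_j|^2 + S = n - 1, with S the sum of all squared norms;
    summing again over j gives 2 S = n - 1. *)
Lemma simplex_dot_self i : dot (delta i) (delta i) = (n%:R - 1) / (2 * n%:R).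
Proof.
pose S := \sum_j dot (delta j) (delta j).
have key j : n%:R * dot (delta j) (delta j) + S = n%:R - 1.
  rewrite -(sum_neq j) -(eq_bigr _ (fun k _ => simplex_dotBB j k)).
  rewrite (eq_bigr _ (fun k _ => dotBB (delta j) (delta k))).
  rewrite sumrB big_split /= sumr_const card_ord mulr_natl -mulr_sumr.
  have := dot_sumr (delta j) (fun=> 1) delta.
  rewrite (eq_bigr delta) => [|k _]; last by rewrite scale1r.
  rewrite simplex_sum0 /dot mulmx0 mxE.
  rewrite [X in _ = X](eq_bigr (fun k => dot (delta j) (delta k))) => [<-|k _].
    by rewrite mulr0 subr0.
  by rewrite mul1r.
have S2 : 2 * S = n%:R - 1.
  apply: (mulfI n_neq0).
  have : \sum_(j < n) (n%:R * dot (delta j) (delta j) + S) = \sum_(j < n) (n%:R - 1).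
    by apply: eq_bigr => j _; exact: key.
  rewrite big_split /= -mulr_sumr -/S !sumr_const card_ord.
  rewrite -[S *+ n]mulr_natl -[_ *+ n in RHS]mulr_natl => <-; ring.
have := key i; move: S2; set D := dot _ _ => S2 kD.
apply: (mulfI n_neq0); have -> : n%:R * D = n%:R - 1 - S by rewrite -kD addrK.
by rewrite (_ : S = (n%:R - 1) / 2); [field | rewrite -S2; field].
Qed.

(** Polarization: the squared side and the two squared norms determine the dot product. *)
Lemma simplex_dot i j :
  dot (delta i) (delta j) = (i == j)%:R / 2 - (2 * n%:R)^-1.
Proof.
have := dotBB (delta i) (delta j); rewrite simplex_dotBB !simplex_dot_self.
set D := dot _ _ => h.
have -> : D = ((n%:R - 1) / n%:R - (i != j)%:R) / 2 by rewrite h; field.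
by case: (i == j) => /=; field.
Qed.

(** The dot product of the relation with [delta i] sees the Gram matrix I/2 - J/(2n), J the all-ones
    matrix, and reads c_i / 2 = (sum of c) / (2n). *)
Lemma simplex_dependency (c : 'I_n -> R) :
  \sum_j c j *: delta j = 0 -> forall i, n%:R * c i = \sum_j c j.
Proof.
move=> c0 i; have := dot_sumr (delta i) c delta.
rewrite c0 {1}/dot mulmx0 mxE.
rewrite (eq_bigr (fun j => (i == j)%:R * c j / 2 - c j * (2 * n%:R)^-1)); last first.
  by move=> j _; rewrite simplex_dot; ring.
rewrite sumrB -!mulr_suml (bigD1 i)//= eqxx mul1r big1 => [|j ji]; last first.
  by rewrite eq_sym (negPf ji) mul0r.
rewrite addr0 => /esym/subr0_eq h.
have -> : n%:R * c i = 2 * n%:R * (c i / 2) by field.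
by rewrite h; field.
Qed.

End CenteredSimplex.

(** * Maximal minors and affine dependencies *)

Section AffineDependency.
Variables (R : realType) (d : nat) (x : 'I_d.+2 -> 'cV[R]_d).

Definition affine_dependency (c : 'I_d.+2 -> R) :=
  \sum_p c p = 0 /\ \sum_p c p *: x p = 0.

(** Its column deletions are the matrices [Xmx x l], and its kernel consists of the affine
    dependencies. *)
Definition point_mx : 'M[R]_(1 + d, d.+2) :=
  \matrix_(i, p) (col_mx (const_mx 1 : 'cV_1) (x p)) i 0.

Lemma affine_dependencyP (c : 'I_d.+2 -> R) :
  affine_dependency c <-> forall i, \sum_p point_mx i p * c p = 0.
Proof.
have e1 (i : 'I_1) : \sum_p point_mx (lshift d i) p * c p = \sum_p c p.
  by apply: eq_bigr => p _; rewrite mxE col_mxEu mxE mul1r.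
have e2 (i : 'I_d) : \sum_p point_mx (rshift 1 i) p * c p = (\sum_p c p *: x p) i 0.
  by rewrite summxE; apply: eq_bigr => p _; rewrite mxE col_mxEd mxE mulrC.
split=> [[c1 c2] i|h].
  by case: (split_ordP i) => j ->; rewrite ?e1 ?e2 ?c1 ?c2 ?mxE.
split; first by rewrite -(e1 0).
by apply/matrixP => i j; rewrite (ord1 j) -e2 h mxE.
Qed.

(* Laplace expansion, along the repeated row, of a determinant with two equal
   rows. *)
Lemma triangle_dependency : affine_dependency (triangle x).
Proof.
apply/affine_dependencyP => i.
pose B : 'M[R]_(1 + (1 + d)) := col_mx (row i point_mx) point_mx.
have B0 : \det B = 0.
  apply: (@determinant_alternate _ _ _ (lshift _ 0) (rshift 1 i)) => // j.
  by rewrite col_mxEu col_mxEd mxE.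
rewrite -[RHS]B0 (expand_det_row _ (lshift _ 0)); apply: eq_bigr => p _.
rewrite col_mxEu [in RHS]mxE; congr (_ * _); rewrite /triangle /cofactor.
have -> : Xmx x p = row' (lshift _ 0) (col' p B).
  apply/matrixP => k l; rewrite [RHS]mxE [RHS]mxE.
  have -> : lift (lshift d.+1 (0 : 'I_1)) k = rshift 1 k by apply: val_inj.
  by rewrite [RHS]col_mxEd mxE.
(* The sign exponents [p.+2] in [triangle] and [0 + p] in the cofactor differ by two. *)
by rewrite !exprS !mulN1r opprK.
Qed.

(** A kernel vector of a singular [Xmx x l], extended by 0 at [l], would be a nontrivial dependency
    vanishing at [l]. *)
Lemma triangle_neq0 (l : 'I_d.+2) :
  (forall c, affine_dependency c -> c l = 0 -> forall p, c p = 0) ->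
  triangle x l != 0.
Proof.
move=> hl; rewrite mulf_neq0 ?signr_eq0//.
(* [det0P] yields a left kernel vector; transposing turns it into a relation between columns. *)
apply/negP; rewrite -det_tr => /det0P [v v0 vX].
case/negP: v0; apply/eqP/rowP => q; rewrite mxE.
pose c p := if unlift l p is Some q then v 0 q else 0.
have cl q' : c (lift l q') = v 0 q' by rewrite /c liftK.
rewrite -cl; apply: hl; last by rewrite /c unlift_none.
apply/affine_dependencyP => i.
rewrite (bigD1_ord l)//= {1}/c unlift_none mulr0 add0r.
move/rowP/(_ i): vX; rewrite !mxE => vXi; rewrite -[RHS]vXi.
by apply: eq_bigr => q' _; rewrite cl mulrC [in RHS]mxE [Xmx _ _ _ _]mxE.
Qed.

End AffineDependency.

(** * Two apexes on an axis and a simplex in the orthogonal hyperplane *)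

Lemma dot_prod_pointB (R : realType) n (t t' : R) (u u' : 'cV[R]_n) :
  dot (@prod_point R n.+1 t u - @prod_point R n.+1 t' u')
      (@prod_point R n.+1 t u - @prod_point R n.+1 t' u') =
  (t - t') ^+ 2 + dot (u - u') (u - u').
Proof.
rewrite /= (opp_col_mx (m1 := 1)) (add_col_mx (m1 := 1)) (@dot_col_mx R 1 n).
by rewrite dotE big_ord1 !mxE.
Qed.

(** The index set splits as 2 + d, as in [position]: two bodies on the first axis, then the simplex
    vertices. *)
Definition apex d (q : 'I_2) : 'I_d.+2 := lshift d q.
Definition vertex d (j : 'I_d) : 'I_d.+2 := rshift 2 j.

Lemma sum_bodies (V : zmodType) d (F : 'I_d.+2 -> V) :
  \sum_p F p = F (apex d 0) + F (apex d 1) + \sum_j F (vertex j).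
Proof.
rewrite (@big_split_ord _ _ _ 2 d) /= big_ord_recl big_ord1.
by congr (_ + F _ + _); apply: val_inj.
Qed.

Section Position.
Variables (R : realType) (n : nat) (z w : R).
Variable delta : 'I_n.+1 -> 'cV[R]_n.
Hypothesis hdelta : regular_simplex 1 delta.
Hypothesis hcenter : barycenter delta = 0.
Let d := n.+1.
Let x : 'I_d.+2 -> 'cV[R]_d := position z w (delta : 'I_d -> 'cV[R]_d.-1).

Lemma position_apexes q : x (apex d q) = @prod_point R d (if q == 0 then z else w) 0.
Proof. by rewrite /x /position /apex (unsplitK (inl q)). Qed.

Lemma position_simplex j : x (vertex j) = @prod_point R d 0 (delta j).
Proof. by rewrite /x /position /vertex (unsplitK (inr j)). Qed.

(** The first coordinate vanishes on the simplex and yields the relation between the apex weights.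
    The other coordinates vanish at the apexes and leave a linear relation of the centered simplex,
    so its weights are equal; the zero total fixes their common value. *)
Lemma position_dependency (c : 'I_d.+2 -> R) : affine_dependency x c ->
  [/\ c (apex d 0) * z + c (apex d 1) * w = 0
    & forall j, d%:R * c (vertex j) = - (c (apex d 0) + c (apex d 1))].
Proof.
case=> c1 c2.
have {}c1 : \sum_j c (vertex j) = - (c (apex d 0) + c (apex d 1)).
  by apply/eqP; rewrite -addr_eq0 addrC -sum_bodies c1.
move: c2; rewrite sum_bodies !position_apexes /= => c2.
have cu := congr1 (@usubmx R 1 n 1) c2; have cd := congr1 (@dsubmx R 1 n 1) c2.
split.
  move: cu; rewrite !linearD !linearZ linear_sum linear0 /= !col_mxKu.
  rewrite big1 => [|j _]; last first.
    by rewrite linearZ position_simplex /= col_mxKu (_ : const_mx 0 = 0) ?scaler0.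
  by move=> /matrixP/(_ 0 0); rewrite !mxE addr0.
move: cd; rewrite !linearD !linearZ linear_sum linear0 /= !col_mxKd !scaler0 !add0r.
rewrite (eq_bigr (fun j => c (vertex j) *: delta j)) => [|j _]; last first.
  by rewrite linearZ position_simplex /= col_mxKd.
by move=> cd j; rewrite (simplex_dependency _ hdelta hcenter cd)// c1 opprD.
Qed.

Lemma position_dist_apexes :
  dot (x (apex d 0) - x (apex d 1)) (x (apex d 0) - x (apex d 1)) = (z - w) ^+ 2.
Proof.
by rewrite !position_apexes dot_prod_pointB subrr /dot mulmx0 mxE addr0.
Qed.

(** Pythagoras, with (d-1)/(2d) the squared circumradius of the simplex. *)
Lemma position_dist_apex_simplex q j :
  dot (x (apex d q) - x (vertex j)) (x (apex d q) - x (vertex j)) =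
  (d%:R - 1) / (2 * d%:R) + (if q == 0 then z else w) ^+ 2.
Proof.
rewrite position_apexes position_simplex dot_prod_pointB subr0 sub0r addrC.
by rewrite dotNN -(simplex_dot_self _ hdelta hcenter j).
Qed.

Lemma position_dist_simplex i j : i != j ->
  dot (x (vertex i) - x (vertex j)) (x (vertex i) - x (vertex j)) = 1.
Proof.
move=> ij; rewrite !position_simplex dot_prod_pointB subrr expr0n add0r.
by rewrite simplex_dotBB// ij.
Qed.

(** If one vertex weight is 0, the apex weights are opposite; as z and w differ, both vanish, and
    then so do all vertex weights. *)
Lemma position_triangle_neq0 j : z != w -> triangle x (vertex j) != 0.
Proof.
move=> zw; apply: triangle_neq0 => c /position_dependency[h hj] cj.
move: (hj j); rewrite cj mulr0 => /esym/eqP; rewrite oppr_eq0 addr_eq0 => /eqP c01.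
have c1 : c (apex d 1) = 0.
  apply: (@mulIf _ (w - z)); first by rewrite subr_eq0 eq_sym.
  by rewrite mul0r -h c01; ring.
move: c01; rewrite c1 oppr0 => c0 p; case: (@split_ordP 2 d p) => q ->.
  by case: q => [[|[|//]] hq]; [rewrite -c0|rewrite -c1]; congr (c _); apply: val_inj.
have := hj q; rewrite c0 c1 addr0 oppr0 => /eqP.
by rewrite mulf_eq0 pnatr_eq0 /= => /eqP.
Qed.

End Position.

(** * From the L-equations to the system *)

Lemma eq0_of_proportional (R : idomainType) (p q u v : R) :
  p != 0 -> q != 0 -> p * u = q * v -> u = 0 <-> v = 0.
Proof.
move=> p0 q0 e; split=> [u0|v0].
  by apply: (mulfI q0); rewrite -e u0 !mulr0.
by apply: (mulfI p0); rewrite e v0 !mulr0.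
Qed.

Theorem proposition8 (R : realType) (d : nat) (a s k z w : R)
    (delta : 'I_d -> 'cV[R]_d.-1)
    (hd : (2 <= d)%N) (hs : s != 0) (hk : k != 0) (hzw : z > w)
    (hdelta : regular_simplex 1 delta) (hcenter : barycenter delta = 0) :
  let x := position z w delta in
  let m := mass s k in
  (L1324 a m x = 0 /\ L2314 a m x = 0) <->
  (k * ((z - w) `^ (2 * a) - ((d%:R - 1) / (2 * d%:R) + w ^+ 2) `^ a) * (z - w)
     + (((d%:R - 1) / (2 * d%:R) + z ^+ 2) `^ a - 1) * z * d%:R = 0
   /\
   s * ((z - w) `^ (2 * a) - ((d%:R - 1) / (2 * d%:R) + z ^+ 2) `^ a) * (z - w)
     - (((d%:R - 1) / (2 * d%:R) + w ^+ 2) `^ a - 1) * w * d%:R = 0).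
Proof.
(* Writing d as [n.+2] provides the two simplex vertices that serve as bodies 3 and 4. *)
move=> x m; case: d delta hd hdelta hcenter @x @m => [//|[//|n]] delta _ hdelta hcenter x m.
set d := n.+2; pose j0 : 'I_d := 0; pose j1 : 'I_d := 1.
have b1 : body 1 = apex d 0 by apply: val_inj; rewrite /= inordK.
have b2 : body 2 = apex d 1 by apply: val_inj; rewrite /= inordK.
have b3 : body 3 = vertex j0 by apply: val_inj; rewrite /= inordK.
have b4 : body 4 = vertex j1 by apply: val_inj; rewrite /= inordK.
have m1 : m (body 1) = s by rewrite /m /mass eqxx.
have m2 : m (body 2) = k by rewrite /m /mass eqxx b1 b2.
have m4 : m (body 4) = 1 by rewrite /m /mass b1 b2 b4.
(* Since z - w is nonnegative, ((z - w)^2)^a equals (z - w)^(2a). *)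
have r12 : Rpow a x (apex d 0) (apex d 1) = (z - w) `^ (2 * a).
  rewrite /Rpow enorm_powR position_dist_apexes powRrM powR_mulrn//.
  by rewrite subr_ge0 ltW.
have rav q j : Rpow a x (apex d q) (vertex j) =
    ((d%:R - 1) / (2 * d%:R) + (if q == 0 then z else w) ^+ 2) `^ a.
  by rewrite /Rpow enorm_powR position_dist_apex_simplex.
(* The unit side length produces the constant 1 in the system. *)
have rvv : Rpow a x (vertex j0) (vertex j1) = 1.
  by rewrite /Rpow enorm_powR position_dist_simplex// powR1.
have [h hj] := position_dependency hdelta hcenter (triangle_dependency x).
rewrite /L1324 /L2314 m1 m2 m4 b1 b2 b3 b4 r12 !rav rvv !eqxx /=.
have T_neq0 : triangle x (vertex j1) != 0.
  by apply: position_triangle_neq0 => //; rewrite gt_eqF.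
move: h (hj j1) T_neq0; set T0 := triangle x _; set T1 := triangle x (apex d 1).
set T := triangle x _ => h hT T_neq0.
have zw0 : z - w != 0 by rewrite subr_eq0 gt_eqF.
(* Eliminate [T1], and below [T0], between T0 z + T1 w = 0 and d T = -(T0 + T1). *)
have eT0 : (z - w) * T0 = d%:R * T * w.
  by rewrite hT -[LHS]subr0 -h; ring.
have eT1 : (z - w) * T1 = - (d%:R * T * z).
  by rewrite hT -[LHS]addr0 -h; ring.
(* [A] and [B] stand for the two differences of [Rpow] values. The factor z - w makes the apex minor
   a multiple of [T], which then factors out. *)
have prop1 A B :
    (z - w) * (k * A * T - 1 * B * T1) = T * (k * A * (z - w) + B * z * d%:R).
  by rewrite mulrBr [_ * (1 * B * T1)]mulrCA eT1; ring.
have prop2 A B :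
    (z - w) * (s * A * T - 1 * B * T0) = T * (s * A * (z - w) - B * w * d%:R).
  by rewrite mulrBr [_ * (1 * B * T0)]mulrCA eT0; ring.
have E1 := eq0_of_proportional zw0 T_neq0 (prop1 _ _).
have E2 := eq0_of_proportional zw0 T_neq0 (prop2 _ _).
by split=> -[/E1 e1 /E2 e2].
Qed.
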